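(* Let $\alpha_1>0$, $\beta_1<0$, $\alpha_2>0$, $\beta_2>0$. Let $f_n(x)=f(x;\lambda_n)$ and $f_{n+1}(x)=f(x;\lambda_{n+1})$, where $0<\lambda_n<\lambda_{n+1}$ are (consecutively indexed) eigenvalues of the boundary value problem $$(p(x)f')'-(q(x)-\lambda r(x))f=0\quad (0<x<L),\qquad f'(0)=(\alpha_1\lambda+\alpha_2)f(0),\qquad f'(L)=(\beta_1\lambda-\beta_2)f(L).$$ Then between two consecutive zeros of $f_{n+1}$ there is exactly one zero of $f_n$.
   Context: Here $L>0$ and $p,q,r$ are positive and sufficiently regular real functions on $[0,L]$ (regular enough that solutions are classical and the classical results on regularity of solutions of second order linear ODEs with respect to parameters, such as Peano's theorem, apply). $\alpha_1,\alpha_2,\beta_1,\beta_2$ are real constants. $f(x;\lambda)$ denotes the solution of the ODE satisfying the boundary condition at $x=0$, normalized by $f(0;\lambda)=1$; at an eigenvalue it is an eigenfunction. The eigenvalues of the problem are real and are indexed as $\lambda_{-1}<\lambda_{-0}<0<\lambda_0<\lambda_1<\lambda_2<\dots\nearrow\infty$, with $f(x;\lambda_l)$ having exactly $|l|$ zeros in $]0,L[$ ($-0$ and $0$ are distinct labels with $|-0|=|0|=0$); so $\lambda_n,\lambda_{n+1}$, $n\ge 0$, are consecutive positive eigenvalues. Zeros are those in $]0,L[$. *)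

(* Defs.v *)
From Stdlib Require Import Reals List.
Open Scope R_scope.

(** The coefficients are total functions on [R], but only their values on
    [0, len] are ever used. *)
Record sl_problem : Type := SLProblem {
  len : R;
  p : R -> R;
  q : R -> R;
  r : R -> R;
  alpha1 : R;
  alpha2 : R;
  beta1 : R;
  beta2 : R
}.

Definition closed_itv (P : sl_problem) (x : R) : Prop := 0 <= x <= len P.

(** Derivatives and continuity are taken relative to [0, len], hence are
    one-sided at the two end points. *)
Definition derivative_of (P : sl_problem) (f df : R -> R) : Prop :=
  forall x, closed_itv P x -> D_in f df (closed_itv P) x.

Definition continuous_on (P : sl_problem) (f : R -> R) : Prop :=
  forall x, closed_itv P x -> continue_in f (closed_itv P) x.

Definition positive_on (P : sl_problem) (f : R -> R) : Prop :=
  forall x, closed_itv P x -> 0 < f x.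

(** Regularity for which all solutions are classical (of class C^2 on
    [0, len]): p of class C^1, and q, r continuous. *)
Definition regular_coefficients (P : sl_problem) : Prop :=
  0 < len P /\
  (positive_on P (p P) /\ positive_on P (q P) /\ positive_on P (r P)) /\
  (exists dp, derivative_of P (p P) dp /\ continuous_on P dp) /\
  continuous_on P (q P) /\
  continuous_on P (r P).

(** (p f')' - (q - lam r) f = 0 on [0, len], where [df] is f'. *)
Definition solves_ode (P : sl_problem) (lam : R) (f df : R -> R) : Prop :=
  derivative_of P f df /\
  exists dflux,
    derivative_of P (fun x => p P x * df x) dflux /\
    forall x, closed_itv P x -> dflux x - (q P x - lam * r P x) * f x = 0.

Definition left_bc (P : sl_problem) (lam : R) (f df : R -> R) : Prop :=
  df 0 = (alpha1 P * lam + alpha2 P) * f 0.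

Definition right_bc (P : sl_problem) (lam : R) (f df : R -> R) : Prop :=
  df (len P) = (beta1 P * lam - beta2 P) * f (len P).

(** [f] is f( . ; lam); nothing is required at the right end point. *)
Definition normalized_solution (P : sl_problem) (lam : R) (f : R -> R) : Prop :=
  exists df, solves_ode P lam f df /\ left_bc P lam f df /\ f 0 = 1.

Definition is_eigenvalue (P : sl_problem) (lam : R) : Prop :=
  exists f df,
    solves_ode P lam f df /\ left_bc P lam f df /\ right_bc P lam f df /\
    exists x, closed_itv P x /\ f x <> 0.

Definition is_zero (P : sl_problem) (f : R -> R) (x : R) : Prop :=
  0 < x < len P /\ f x = 0.

Definition has_exactly_zeros (P : sl_problem) (f : R -> R) (k : nat) : Prop :=
  exists zs : list R,
    NoDup zs /\ length zs = k /\ forall x, In x zs <-> is_zero P f x.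

Definition consecutive_zeros (P : sl_problem) (f : R -> R) (a b : R) : Prop :=
  is_zero P f a /\ is_zero P f b /\ a < b /\
  forall x, a < x < b -> ~ is_zero P f x.

(** The labels -1, -0, 0, 1, 2, ...; here -0 and 0 are distinct. *)
Inductive label : Type :=
| Minus1 : label
| Minus0 : label
| Plus : nat -> label.

Definition label_abs (l : label) : nat :=
  match l with
  | Minus1 => 1
  | Minus0 => 0
  | Plus n => n
  end.

(** [lam] is the indexing of the eigenvalues
    lam_{-1} < lam_{-0} < 0 < lam_0 < lam_1 < ... -> oo,
    in which f( . ; lam_l) has exactly |l| zeros in the open interval. *)
Definition eigenvalue_indexing (P : sl_problem) (lam : label -> R) : Prop :=
  (forall mu, is_eigenvalue P mu <-> exists l, mu = lam l) /\
  lam Minus1 < lam Minus0 /\ lam Minus0 < 0 /\ 0 < lam (Plus 0) /\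
  (forall n, lam (Plus n) < lam (Plus (S n))) /\
  cv_infty (fun n => lam (Plus n)) /\
  (forall l f, normalized_solution P (lam l) f ->
     has_exactly_zeros P f (label_abs l)).

(* Main.v *)
From Stdlib Require Import Reals List Ranalysis5 Lra Lia Classical.
From Coquelicot Require Import Coquelicot.
Require Import Defs.
Open Scope R_scope.

(** Write [lam < mu] for the two eigenvalues, [f], [g] for their
    eigenfunctions and [w = p f'], [v = p g'] for the fluxes.  Since [f] has
    [n] zeros and [g] has [n + 1], it is enough to know that each of the
    [n + 1] intervals into which the zeros of [f] cut the open interval
    (0, L) contains a zero of [g]: then each contains exactly one, and the
    zeros interlace.

    For an interval between two zeros of [f] this is Sturm's comparison
    theorem ([sturm_comparison]), by monotonicity of the Wronskian
    [f v - w g].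

    At an end interval the comparison is delicate: the boundary condition at 0
    gives [g] the larger logarithmic derivative, which pushes the first zero
    of [g] to the right, against the effect of the larger eigenvalue.  The
    second effect wins ([endpoint_comparison]).  The reason is that, with
    [w = (A lam + B) f] at the end point, an eigenvalue is a critical value of
    a Rayleigh quotient whose numerator
    [int (p f'^2 + q f^2) + B f(0)^2] is positive, while the denominator
    [int r f^2 - A f(0)^2] is indefinite; the numerator being [lam] times the
    denominator, the denominator is positive at [f], and that is the sign
    which the Picone identity needs to forbid a positive [g].  Without
    integrals, both facts are carried by the function
    [K = mu w f - lam v f^2 / g], which is nondecreasing where [g] is positive
    because
<<
  K' = (mu - lam) (q f^2 + w^2 / p) + lam (w - v f / g)^2 / p,
>>
    which equals [(mu - lam) B f^2 > 0] at the end point, and which is at most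
    [(mu - lam) w f], hence has no positive limit, at the first zero of [f].
    The other end is treated by reflection; there one needs that a normalized
    solution at an eigenvalue satisfies the right boundary condition and does
    not vanish at L, and both follow from uniqueness for the initial value
    problem ([sl_system_zero_data], [eigenfunction_system]).

    The counting step is [interlacing_by_counting].  A solution on [0, L] has
    one-sided derivatives at the ends; it is replaced by an extension to the
    line that is differentiable in the usual sense at every point of [0, L]
    ([differentiable_extension]). *)

(** * Real functions of one variable *)

(** [auto_derive] leaves derivatives of the eta-expanded functions. *)
Ltac rewrite_derive h :=
  match type of h with
  | is_derive ?f ?x ?l =>
      rewrite (is_derive_unique (fun t : R => f t) x l h)
  end.

Lemma deriv_nonneg_le (f df : R -> R) (a b : R) :
  a <= b ->
  (forall x, a <= x <= b -> is_derive f x (df x)) ->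
  (forall x, a < x < b -> 0 <= df x) ->
  f a <= f b.
Proof.
  intros hab hf hdf.
  destruct (Req_dec a b) as [->|hne]; [lra|].
  destruct (MVT_cor2 f df a b) as [c [e hc]]; [lra| |].
  - intros c hc; apply is_derive_Reals, hf, hc.
  - specialize (hdf c hc); nra.
Qed.

Lemma deriv_neg_lt (f df : R -> R) (a b : R) :
  a < b ->
  (forall x, a <= x <= b -> is_derive f x (df x)) ->
  (forall x, a < x < b -> df x < 0) ->
  f b < f a.
Proof.
  intros hab hf hdf.
  destruct (MVT_cor2 f df a b) as [c [e hc]]; [lra| |].
  - intros c hc; apply is_derive_Reals, hf, hc.
  - specialize (hdf c hc); nra.
Qed.

Lemma is_derive_continuity_pt (f : R -> R) (x l : R) :
  is_derive f x l -> continuity_pt f x.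
Proof.
  intros h; apply derivable_continuous_pt; exists l.
  now apply is_derive_Reals.
Qed.

Lemma continuous_ge_at_right_end (f : R -> R) (a c k : R) :
  a < c -> continuity_pt f c ->
  (forall x, a <= x < c -> k <= f x) -> k <= f c.
Proof.
  intros hac hf hk.
  destruct (Rle_or_lt k (f c)) as [|hlt]; [assumption|exfalso].
  destruct (hf (k - f c)) as [d [hd H]]; [lra|].
  set (x := Rmax a (c - d / 2)).
  assert (hx : a <= x < c /\ c - d / 2 <= x).
  { unfold x, Rmax; destruct (Rle_dec a (c - d / 2)); lra. }
  specialize (hk x (proj1 hx)).
  assert (hdist : Rabs (f x - f c) < k - f c).
  { apply H; split.
    - split; [exact I|lra].
    - simpl; unfold Rdist; apply Rabs_def1; lra. }
  apply Rabs_def2 in hdist; lra.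
Qed.

Lemma deriv_at_zero_after_pos (f : R -> R) (a c l : R) :
  a < c -> is_derive f c l -> f c = 0 ->
  (forall x, a < x < c -> 0 < f x) -> l <= 0.
Proof.
  intros hac hf fc hpos.
  destruct (Rle_or_lt l 0) as [|hl]; [assumption|exfalso].
  apply is_derive_Reals in hf.
  destruct (hf l hl) as [d H].
  pose proof (cond_pos d) as hd.
  set (h := Rmax ((a - c) / 2) (- (d / 2))).
  assert (hh : (a - c) / 2 <= h /\ - (d / 2) <= h < 0).
  { unfold h, Rmax; destruct (Rle_dec ((a - c) / 2) (- (d / 2))); lra. }
  assert (hq : Rabs ((f (c + h) - f c) / h - l) < l).
  { apply H; [lra|apply Rabs_def1; lra]. }
  assert (hfx : 0 < f (c + h)) by (apply hpos; lra).
  apply Rabs_def2 in hq.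
  assert (hz : (f (c + h) - f c) / h * h = f (c + h)) by (rewrite fc; field; lra).
  nra.
Qed.

Lemma is_derive_reflect (f : R -> R) (x l : R) :
  is_derive f (- x) l -> is_derive (fun t => f (- t)) x (- l).
Proof.
  intros h.
  replace (- l) with (scal (- (1)) l)
    by (unfold scal; simpl; unfold mult; simpl; ring).
  now apply (is_derive_comp f Ropp); [|auto_derive].
Qed.

Lemma deriv_at_zero_before_pos (f : R -> R) (a c l : R) :
  a < c -> is_derive f a l -> f a = 0 ->
  (forall x, a < x < c -> 0 < f x) -> 0 <= l.
Proof.
  intros hac hf fa hpos.
  enough (- l <= 0) by lra.
  apply (deriv_at_zero_after_pos (fun x => f (- x)) (- c) (- a)).
  - lra.
  - apply is_derive_reflect; now rewrite Ropp_involutive.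
  - now rewrite Ropp_involutive.
  - intros x hx; apply hpos; lra.
Qed.

Lemma nonvanishing_sign (f : R -> R) (I : R -> Prop) :
  (forall x y z, I x -> I z -> x <= y <= z -> I y) ->
  (forall x, I x -> continuity_pt f x) ->
  (forall x, I x -> f x <> 0) ->
  (forall x, I x -> 0 < f x) \/ (forall x, I x -> 0 < - f x).
Proof.
  intros hI hc hne.
  destruct (classic (exists x, I x /\ f x < 0)) as [[x [Ix fx]]|hno].
  - right; intros y Iy.
    destruct (Rtotal_order (f y) 0) as [|[e|fy]]; [lra|now destruct (hne y)|].
    exfalso.
    destruct (Rtotal_order x y) as [hxy|[->|hyx]]; [|lra|].
    + destruct (IVT_interv f x y) as [z [hz fz]]; auto.
      * intros t ht; apply hc, (hI x t y); auto.
      * now apply (hne z); [apply (hI x z y)|].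
    + destruct (IVT_interv (fun t => - f t) y x) as [z [hz fz]]; auto; try lra.
      * intros t ht; apply continuity_pt_opp, hc, (hI y t x); auto.
      * apply (hne z); [apply (hI y z x); auto|lra].
  - left; intros y Iy.
    destruct (Rtotal_order (f y) 0) as [fy|[e|fy]]; [|now destruct (hne y)|lra].
    now destruct hno; exists y.
Qed.

(** * The first order system *)

(** The equation [(p f')' = (q - lam r) f] in the unknowns [f] and [w = p f'];
    in this form only values of [p] occur, never its derivative. *)
Definition sl_system (p q r : R -> R) (lam a b : R) (f w : R -> R) : Prop :=
  forall x, a <= x <= b ->
    is_derive f x (w x / p x) /\
    is_derive w x ((q x - lam * r x) * f x).

Lemma sl_system_sub p q r lam a b a' b' f w :
  a <= a' -> b' <= b ->
  sl_system p q r lam a b f w -> sl_system p q r lam a' b' f w.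
Proof. intros h1 h2 h x hx; apply h; lra. Qed.

Lemma sl_system_lincomb p q r lam a b f w g v k :
  sl_system p q r lam a b f w -> sl_system p q r lam a b g v ->
  sl_system p q r lam a b (fun x => k * f x + g x) (fun x => k * w x + v x).
Proof.
  intros hf hg x hx.
  destruct (hf x hx) as [f1 w1]; destruct (hg x hx) as [g1 v1].
  split; (evar_last;
    [apply (is_derive_plus (K := R_AbsRing) (V := R_NormedModule));
     [apply is_derive_scal|]; eassumption
    |unfold plus; simpl; unfold Rdiv; ring]).
Qed.

Lemma sl_system_opp p q r lam a b f w :
  sl_system p q r lam a b f w ->
  sl_system p q r lam a b (fun x => - f x) (fun x => - w x).
Proof.
  intros hf x hx; destruct (hf x hx) as [f1 w1].
  split; (evar_last;
    [apply (is_derive_opp (K := R_AbsRing) (V := R_NormedModule)); eassumption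
    |unfold opp; simpl; unfold Rdiv; ring]).
Qed.

Lemma sl_system_reflect p q r lam a b f w :
  sl_system p q r lam a b f w ->
  sl_system (fun x => p (- x)) (fun x => q (- x)) (fun x => r (- x)) lam
    (- b) (- a) (fun x => f (- x)) (fun x => - w (- x)).
Proof.
  intros h x hx.
  destruct (h (- x)) as [f1 w1]; [lra|].
  split.
  - evar_last; [apply is_derive_reflect, f1|unfold Rdiv; ring].
  - evar_last.
    + apply (is_derive_opp (K := R_AbsRing) (V := R_NormedModule)
               (fun t => w (- t))).
      apply is_derive_reflect, w1.
    + unfold opp; simpl; ring.
Qed.

Lemma sl_system_continuity_pt p q r lam a b f w x :
  sl_system p q r lam a b f w -> a <= x <= b -> continuity_pt f x.
Proof. intros h hx; eapply is_derive_continuity_pt, (h x hx). Qed.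

(** Uniqueness for the initial value problem.  The energy [f^2 + w^2] has
    derivative [2 (1 / p + q - lam r) f w], at most [C] times the energy in
    absolute value, so its product with [exp (C x)] is nondecreasing and its
    product with [exp (- C x)] nonincreasing; both are nonnegative and vanish
    at [x0], hence the first vanishes before [x0] and the second after. *)
Lemma sl_system_zero_data p q r lam a b C f w x0 :
  (forall x, a <= x <= b -> Rabs (/ p x + (q x - lam * r x)) <= C) ->
  sl_system p q r lam a b f w -> a <= x0 <= b -> f x0 = 0 -> w x0 = 0 ->
  forall x, a <= x <= b -> f x = 0 /\ w x = 0.
Proof.
  intros hC hf hx0 f0 w0 x hx.
  set (m := fun t => / p t + (q t - lam * r t)).
  set (E := fun k t => exp (k * t) * (f t * f t + w t * w t)).
  set (dE := fun k t => exp (k * t) *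
    (k * (f t * f t + w t * w t) + 2 * m t * (f t * w t))).
  assert (hE : forall k t, a <= t <= b -> is_derive (E k) t (dE k t)).
  { intros k t ht; destruct (hf t ht) as [f1 w1].
    unfold E; auto_derive.
    - repeat split; eexists; eassumption.
    - rewrite_derive f1; rewrite_derive w1.
      unfold dE, m, Rdiv; ring. }
  assert (hm : forall t, a <= t <= b ->
    Rabs (2 * m t * (f t * w t)) <= C * (f t * f t + w t * w t)).
  { intros t ht; specialize (hC t ht); fold (m t) in hC.
    replace (2 * m t * (f t * w t)) with (m t * (2 * (f t * w t))) by ring.
    rewrite Rabs_mult.
    apply Rmult_le_compat; try apply Rabs_pos; [exact hC|].
    pose proof (Rle_0_sqr (f t - w t)) as H1.
    pose proof (Rle_0_sqr (f t + w t)) as H2.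
    unfold Rsqr in *.
    apply Rabs_le; lra. }
  assert (E0 : forall k, E k x0 = 0) by (intros k; unfold E; rewrite f0, w0; ring).
  assert (hEx : exists k, E k x <= 0).
  { destruct (Rle_or_lt x x0) as [hle|hlt].
    - exists C; rewrite <- (E0 C).
      apply (deriv_nonneg_le _ (dE C)); [assumption| |].
      + intros t ht; apply hE; lra.
      + intros t ht; unfold dE.
        apply Rmult_le_pos; [left; apply exp_pos|].
        assert (H : a <= t <= b) by lra.
        apply hm, Rabs_le_between in H; lra.
    - exists (- C).
      enough (- E (- C) x0 <= - E (- C) x) by (rewrite E0 in *; lra).
      apply (deriv_nonneg_le (fun t => - E (- C) t) (fun t => - dE (- C) t));
        [lra| |].
      + intros t ht.
        apply (is_derive_opp (K := R_AbsRing) (V := R_NormedModule)).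
        apply hE; lra.
      + intros t ht; unfold dE.
        rewrite Ropp_mult_distr_r.
        apply Rmult_le_pos; [left; apply exp_pos|].
        assert (H : a <= t <= b) by lra.
        apply hm, Rabs_le_between in H; lra. }
  destruct hEx as [k hk]; unfold E in hk.
  pose proof (exp_pos (k * x)) as he.
  pose proof (Rle_0_sqr (f x)) as hf2; pose proof (Rle_0_sqr (w x)) as hw2.
  unfold Rsqr in *.
  assert (hs : f x * f x + w x * w x <= 0).
  { apply Rnot_lt_le; intros H.
    pose proof (Rmult_lt_0_compat _ _ he H); lra. }
  split; apply Rsqr_0_uniq; unfold Rsqr; lra.
Qed.

Lemma is_derive_wronskian p q r lam mu a b f w g v x :
  sl_system p q r lam a b f w -> sl_system p q r mu a b g v ->
  a <= x <= b ->
  is_derive (fun t => f t * v t - w t * g t) x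
    ((lam - mu) * (r x * (f x * g x))).
Proof.
  intros hf hg hx.
  destruct (hf x hx) as [f1 w1]; destruct (hg x hx) as [g1 v1].
  auto_derive.
  - repeat split; eexists; eassumption.
  - rewrite_derive f1; rewrite_derive w1; rewrite_derive g1; rewrite_derive v1.
    unfold Rdiv; ring.
Qed.

(** * Sturm comparison between two zeros *)

(** The Wronskian [f v - w g] decreases strictly, yet it is [- w a * g a <= 0]
    at [a] and [- w b * g b >= 0] at [b]. *)
Lemma sturm_comparison_pos p q r lam mu a b f w g v :
  a < b -> lam < mu ->
  (forall x, a <= x <= b -> 0 < p x) -> (forall x, a <= x <= b -> 0 < r x) ->
  sl_system p q r lam a b f w -> sl_system p q r mu a b g v ->
  f a = 0 -> f b = 0 ->
  (forall x, a < x < b -> 0 < f x) -> (forall x, a < x < b -> 0 < g x) ->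
  False.
Proof.
  intros hab hlm hp hr hf hg fa fb fpos gpos.
  assert (slope : forall x, a <= x <= b -> w x = w x / p x * p x).
  { intros x hx; specialize (hp x hx); field; lra. }
  assert (wa : 0 <= w a).
  { rewrite slope by lra.
    apply Rmult_le_pos; [|left; apply hp; lra].
    apply (deriv_at_zero_before_pos f a b); auto; apply hf; lra. }
  assert (wb : w b <= 0).
  { rewrite slope by lra.
    specialize (hp b ltac:(lra)).
    enough (w b / p b <= 0) by nra.
    apply (deriv_at_zero_after_pos f a b); auto; apply hf; lra. }
  assert (ga : 0 <= g a).
  { rewrite <- (Ropp_involutive a).
    apply (continuous_ge_at_right_end (fun t => g (- t)) (- ((a + b) / 2)) (- a));
      [lra| |].
    - eapply is_derive_continuity_pt, is_derive_reflect.
      rewrite Ropp_involutive; apply hg; lra.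
    - intros x hx; left; apply gpos; lra. }
  assert (gb : 0 <= g b).
  { apply (continuous_ge_at_right_end g ((a + b) / 2) b); [lra| |].
    - eapply sl_system_continuity_pt; [exact hg|lra].
    - intros x hx; left; apply gpos; lra. }
  assert (H : f b * v b - w b * g b < f a * v a - w a * g a).
  { apply (deriv_neg_lt (fun t => f t * v t - w t * g t) _ a b hab
      (fun x hx => is_derive_wronskian _ _ _ _ _ _ _ _ _ _ _ x hf hg hx)).
    intros x hx.
    assert (0 < r x * (f x * g x)).
    { apply Rmult_lt_0_compat; [apply hr; lra|].
      apply Rmult_lt_0_compat; auto. }
    nra. }
  rewrite fa, fb in H; nra.
Qed.

Theorem sturm_comparison p q r lam mu a b f w g v :
  a < b -> lam < mu ->
  (forall x, a <= x <= b -> 0 < p x) -> (forall x, a <= x <= b -> 0 < r x) ->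
  sl_system p q r lam a b f w -> sl_system p q r mu a b g v ->
  f a = 0 -> f b = 0 -> (forall x, a < x < b -> f x <> 0) ->
  exists x, a < x < b /\ g x = 0.
Proof.
  intros hab hlm hp hr hf hg fa fb fne.
  apply NNPP; intros hno.
  assert (gne : forall x, a < x < b -> g x <> 0).
  { intros x hx gx; apply hno; now exists x. }
  assert (sign : forall l h u, sl_system p q r l a b h u ->
    (forall x, a < x < b -> h x <> 0) ->
    (forall x, a < x < b -> 0 < h x) \/ (forall x, a < x < b -> 0 < - h x)).
  { intros l h u hh hne.
    apply (nonvanishing_sign h (fun x => a < x < b)); [intros; lra| |exact hne].
    intros x hx; eapply sl_system_continuity_pt; [exact hh|lra]. }
  destruct (sign _ _ _ hf fne) as [fs|fs], (sign _ _ _ hg gne) as [gs|gs].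
  - exact (sturm_comparison_pos _ _ _ _ _ _ _ _ _ _ _
             hab hlm hp hr hf hg fa fb fs gs).
  - exact (sturm_comparison_pos _ _ _ _ _ _ _ _ _ _ _
             hab hlm hp hr hf (sl_system_opp _ _ _ _ _ _ _ _ hg) fa fb fs gs).
  - apply (sturm_comparison_pos _ _ _ _ _ _ _ _ _ _ _
             hab hlm hp hr (sl_system_opp _ _ _ _ _ _ _ _ hf) hg); auto; lra.
  - apply (sturm_comparison_pos _ _ _ _ _ _ _ _ _ _ _
             hab hlm hp hr (sl_system_opp _ _ _ _ _ _ _ _ hf)
             (sl_system_opp _ _ _ _ _ _ _ _ hg)); auto; lra.
Qed.

(** * Comparison next to an end point with an eigenvalue in its condition *)

(** The function [K] of the introduction; its bound by [(mu - lam) w f] comes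
    from
<<
  K = (mu - lam) w f - lam f (f v - w g) / g
>>
    and the sign of the Wronskian, which decreases to a nonnegative value at
    [c].  This bound makes the argument work also when [g c = 0], where the
    limit of the quotient in [K] is not obvious. *)
Lemma endpoint_comparison_pos p q r lam mu A B a c f w g v :
  a < c -> 0 < lam < mu -> 0 < B ->
  (forall x, a <= x <= c -> 0 < p x) -> (forall x, a <= x <= c -> 0 < q x) ->
  (forall x, a <= x <= c -> 0 < r x) ->
  sl_system p q r lam a c f w -> sl_system p q r mu a c g v ->
  w a = (A * lam + B) * f a -> v a = (A * mu + B) * g a -> f c = 0 ->
  (forall x, a <= x < c -> 0 < f x) -> (forall x, a <= x < c -> 0 < g x) ->
  False.
Proof.
  intros hac hlm hB hp hq hr hf hg wa va fc fpos gpos.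
  assert (gc : 0 <= g c).
  { apply (continuous_ge_at_right_end g a c); [lra| |].
    - eapply sl_system_continuity_pt; [exact hg|lra].
    - intros x hx; left; auto. }
  assert (wc : w c <= 0).
  { assert (hpc : 0 < p c) by (apply hp; lra).
    replace (w c) with (w c / p c * p c) by (field; lra).
    enough (w c / p c <= 0) by nra.
    apply (deriv_at_zero_after_pos f a c); auto.
    - apply hf; lra.
    - intros x hx; apply fpos; lra. }
  (* The Wronskian is nonincreasing, and at c it equals - w c * g c >= 0. *)
  assert (hW : forall y, a <= y < c -> 0 <= f y * v y - w y * g y).
  { intros y hy.
    enough (- (f y * v y - w y * g y) <= - (f c * v c - w c * g c))
      by (rewrite fc in *; nra).
    apply (deriv_nonneg_le (fun t => - (f t * v t - w t * g t))
             (fun t => - ((lam - mu) * (r t * (f t * g t))))); [lra| |].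
    - intros x hx.
      apply (is_derive_opp (K := R_AbsRing) (V := R_NormedModule)
               (fun t => f t * v t - w t * g t)).
      apply (is_derive_wronskian p q r lam mu a c); auto; lra.
    - intros x hx.
      assert (0 < r x * (f x * g x)).
      { apply Rmult_lt_0_compat; [apply hr; lra|].
        apply Rmult_lt_0_compat; [apply fpos|apply gpos]; lra. }
      nra. }
  set (K := fun t => mu * (w t * f t) - lam * (v t * (f t * f t) / g t)).
  set (dK := fun t => (mu - lam) * (q t * (f t * f t) + w t * w t / p t)
    + lam * ((w t - v t * f t / g t) * (w t - v t * f t / g t) / p t)).
  assert (Kmono : forall y, a <= y < c -> K a <= K y).
  { intros y hy; apply (deriv_nonneg_le K dK); [lra| |].
    - intros x hx.
      assert (hx' : a <= x <= c) by lra.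
      destruct (hf x hx') as [f1 w1]; destruct (hg x hx') as [g1 v1].
      pose proof (hp x hx') as px.
      assert (gx : 0 < g x) by (apply gpos; lra).
      unfold K; auto_derive.
      + repeat split; try (eexists; eassumption); lra.
      + rewrite_derive f1; rewrite_derive w1; rewrite_derive g1; rewrite_derive v1.
        unfold dK; field; lra.
    - intros x hx; unfold dK.
      assert (hx' : a <= x <= c) by lra.
      pose proof (hp x hx') as px; pose proof (hq x hx') as qx.
      assert (sq : forall s, 0 <= s * s) by (intros s; apply Rle_0_sqr).
      assert (sqp : forall s, 0 <= s * s / p x).
      { intros s; apply Rdiv_le_0_compat; auto. }
      apply Rplus_le_le_0_compat; apply Rmult_le_pos; try lra; auto.
      apply Rplus_le_le_0_compat; auto.
      apply Rmult_le_pos; auto; lra. }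
  assert (Kle : forall y, a <= y < c -> K y <= (mu - lam) * (w y * f y)).
  { intros y hy; pose proof (fpos y hy) as fy; pose proof (gpos y hy) as gy.
    assert (0 <= f y * (f y * v y - w y * g y) / g y).
    { apply Rdiv_le_0_compat; [|exact gy].
      apply Rmult_le_pos; [lra|auto]. }
    replace (K y) with ((mu - lam) * (w y * f y)
      - lam * (f y * (f y * v y - w y * g y) / g y)) by (unfold K; field; lra).
    nra. }
  assert (Ka : 0 < K a).
  { assert (fa : 0 < f a) by (apply fpos; lra).
    assert (ga : 0 < g a) by (apply gpos; lra).
    replace (K a) with ((mu - lam) * (B * (f a * f a)))
      by (unfold K; rewrite wa, va; field; lra).
    repeat apply Rmult_lt_0_compat; lra. }
  assert (Kc : K a <= (mu - lam) * (w c * f c)).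
  { apply (continuous_ge_at_right_end (fun t => (mu - lam) * (w t * f t)) a c);
      [lra| |].
    - destruct (hf c ltac:(lra)) as [f1 w1].
      apply continuity_pt_scal with (f := fun t => w t * f t).
      apply continuity_pt_mult; eapply is_derive_continuity_pt; eassumption.
    - intros x hx; apply Rle_trans with (K x); auto. }
  rewrite fc in Kc; lra.
Qed.

Theorem endpoint_comparison p q r lam mu A B a c f w g v :
  a < c -> 0 < lam < mu -> 0 < B ->
  (forall x, a <= x <= c -> 0 < p x) -> (forall x, a <= x <= c -> 0 < q x) ->
  (forall x, a <= x <= c -> 0 < r x) ->
  sl_system p q r lam a c f w -> sl_system p q r mu a c g v ->
  w a = (A * lam + B) * f a -> v a = (A * mu + B) * g a ->
  g a <> 0 -> f c = 0 -> (forall x, a <= x < c -> f x <> 0) ->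
  exists x, a < x < c /\ g x = 0.
Proof.
  intros hac hlm hB hp hq hr hf hg wa va ga fc fne.
  apply NNPP; intros hno.
  assert (gne : forall x, a <= x < c -> g x <> 0).
  { intros x hx gx; apply hno; exists x.
    destruct (Req_dec x a) as [->|hne]; [contradiction|].
    split; [lra|exact gx]. }
  assert (sign : forall l h u, sl_system p q r l a c h u ->
    (forall x, a <= x < c -> h x <> 0) ->
    (forall x, a <= x < c -> 0 < h x) \/ (forall x, a <= x < c -> 0 < - h x)).
  { intros l h u hh hne.
    apply (nonvanishing_sign h (fun x => a <= x < c)); [intros; lra| |exact hne].
    intros x hx; eapply sl_system_continuity_pt; [exact hh|lra]. }
  destruct (sign _ _ _ hf fne) as [fs|fs], (sign _ _ _ hg gne) as [gs|gs].
  - apply (endpoint_comparison_pos p q r lam mu A B a c f w g v); auto.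
  - apply (endpoint_comparison_pos p q r lam mu A B a c f w
      (fun x => - g x) (fun x => - v x)); auto using sl_system_opp; lra.
  - apply (endpoint_comparison_pos p q r lam mu A B a c
      (fun x => - f x) (fun x => - w x) g v); auto using sl_system_opp; lra.
  - apply (endpoint_comparison_pos p q r lam mu A B a c
      (fun x => - f x) (fun x => - w x) (fun x => - g x) (fun x => - v x));
      auto using sl_system_opp; lra.
Qed.

(** * Counting zeros *)

Lemma list_nearest_above (l : list R) (c x : R) :
  In x l -> c < x ->
  exists d, In d l /\ c < d /\ forall z, In z l -> c < z -> d <= z.
Proof.
  revert x; induction l as [|y l IH]; intros x hx hcx; [easy|].
  destruct (classic (exists z, In z l /\ c < z)) as [[z [hz hcz]]|hno].
  - destruct (IH z hz hcz) as [d [hd [hcd hmin]]].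
    destruct (classic (c < y < d)) as [hy|hy].
    + exists y; split; [now left|split; [lra|]].
      intros t [->|ht] hct; [lra|].
      specialize (hmin t ht hct); lra.
    + exists d; split; [now right|split; [assumption|]].
      intros t [<-|ht] hct; [lra|auto].
  - destruct hx as [<-|hx]; [|now destruct hno; exists x].
    exists y; split; [now left|split; [assumption|]].
    intros t [<-|ht] hct; [lra|].
    now destruct hno; exists t.
Qed.

Lemma list_nearest_below (l : list R) (c x : R) :
  In x l -> x < c ->
  exists d, In d l /\ d < c /\ forall z, In z l -> z < c -> z <= d.
Proof.
  intros hx hxc.
  destruct (list_nearest_above (map Ropp l) (- c) (- x)) as [d [hd [hcd hmin]]].
  - now apply in_map.
  - lra.
  - apply in_map_iff in hd; destruct hd as [e [<- he]].
    exists e; split; [assumption|split; [lra|]].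
    intros z hz hzc.
    specialize (hmin (- z) (in_map Ropp _ _ hz)); lra.
Qed.

(** Replaces the injective function chosen inside [rel] by its image, so that no
    choice principle is involved. *)
Lemma injective_relation_image {A B : Type} (l : list A) (rel : A -> B -> Prop) :
  NoDup l ->
  (forall x, In x l -> exists y, rel x y) ->
  (forall x x' y, In x l -> In x' l -> rel x y -> rel x' y -> x = x') ->
  exists l', NoDup l' /\ length l' = length l /\
    forall y, In y l' -> exists x, In x l /\ rel x y.
Proof.
  induction l as [|x l IH]; intros hnd hex hinj.
  - exists nil; repeat split; [constructor|easy].
  - inversion hnd as [|? ? hx hnd']; subst.
    destruct IH as [l' [hl' [hlen him]]]; auto.
    + intros; apply hex; now right.
    + intros; eapply hinj; eauto; now right.
    + destruct (hex x) as [y hy]; [now left|].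
      exists (y :: l'); repeat split.
      * constructor; [|assumption].
        intros hin; destruct (him y hin) as [x' [hx' hrel]].
        apply hx; rewrite (hinj x x' y); auto; [now left|now right].
      * simpl; now rewrite hlen.
      * intros z [<-|hz]; [exists x; split; [now left|assumption]|].
        destruct (him z hz) as [x' [hx' hrel]].
        exists x'; split; [now right|assumption].
Qed.

(** If no point of [cs] lay strictly between [a] and [b], send each point of
    [cs] up to [a] to the nearest point of [ds] on its left, and each point of
    [cs] from [b] on to the nearest one on its right.  As points of [ds]
    separate those of [cs], this is injective; it avoids [a] and [b], so [ds]
    would have two more points than [cs]. *)
Lemma interlacing_by_counting (cs ds : list R) (a b : R) :
  NoDup cs -> NoDup ds -> (length ds <= S (length cs))%nat ->
  (forall c c', In c cs -> In c' cs -> c < c' ->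
     exists d, In d ds /\ c < d < c') ->
  (forall c, In c cs -> exists d, In d ds /\ d < c) ->
  (forall c, In c cs -> exists d, In d ds /\ c < d) ->
  In a ds -> In b ds -> a < b ->
  exists c, In c cs /\ a < c < b.
Proof.
  intros hcs hds hlen hgap hbelow habove ha hb hab.
  apply NNPP; intros hno.
  assert (hout : forall c, In c cs -> c <= a \/ b <= c).
  { intros c hc.
    destruct (Rle_or_lt c a); [now left|].
    destruct (Rle_or_lt b c); [now right|].
    destruct hno; now exists c. }
  set (nearest := fun c d => In d ds /\
    ((c <= a /\ d < c /\ forall z, In z ds -> z < c -> z <= d) \/
     (b <= c /\ c < d /\ forall z, In z ds -> c < z -> d <= z))).
  destruct (injective_relation_image cs nearest) as [l [hl [hllen him]]].
  - assumption.
  - intros c hc; destruct (hout c hc) as [hca|hbc].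
    + destruct (hbelow c hc) as [d [hd hdc]].
      destruct (list_nearest_below ds c d hd hdc) as [e [he H]].
      exists e; split; [assumption|left; tauto].
    + destruct (habove c hc) as [d [hd hdc]].
      destruct (list_nearest_above ds c d hd hdc) as [e [he H]].
      exists e; split; [assumption|right; tauto].
  - assert (hlt : forall c c' d, In c cs -> In c' cs -> c < c' ->
      nearest c d -> nearest c' d -> False).
    { intros c c' d hc hc' hcc [hd H] [_ H'].
      destruct (hgap c c' hc hc' hcc) as [e [he hce]].
      destruct H as [[h1 [h2 h3]]|[h1 [h2 h3]]],
        H' as [[h1' [h2' h3']]|[h1' [h2' h3']]]; try lra.
      - specialize (h3' e he); lra.
      - specialize (h3 e he); lra. }
    intros c c' d hc hc' H H'.
    destruct (Rtotal_order c c') as [hlt'|[e|hgt]]; [|assumption|]; exfalso; eauto.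
  - assert (hnd : NoDup (a :: b :: l)).
    { constructor; [|constructor; [|assumption]].
      - intros [e|hin]; [lra|].
        destruct (him a hin) as [c [hc [_ [H|H]]]]; lra.
      - intros hin.
        destruct (him b hin) as [c [hc [_ [H|H]]]]; lra. }
    assert (hincl : incl (a :: b :: l) ds).
    { intros x [<-|[<-|hx]]; try assumption.
      now destruct (him x hx) as [c [_ [hd _]]]. }
    pose proof (NoDup_incl_length hnd hincl) as H; simpl in H; lia.
Qed.

(** * From one-sided to two-sided derivatives *)

Definition clamp (P : sl_problem) (x : R) : R := Rmax 0 (Rmin x (len P)).

Lemma clamp_closed P x : 0 < len P -> closed_itv P (clamp P x).
Proof.
  intros hL; unfold clamp, closed_itv, Rmax, Rmin.
  destruct (Rle_dec x (len P)); destruct (Rle_dec 0 _); lra.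
Qed.

Lemma clamp_id P x : closed_itv P x -> clamp P x = x.
Proof.
  unfold clamp, closed_itv; intros hx.
  rewrite Rmin_left, Rmax_right; lra.
Qed.

Lemma clamp_dist P x y : Rabs (clamp P y - clamp P x) <= Rabs (y - x).
Proof.
  unfold clamp, Rmax, Rmin.
  destruct (Rle_dec x (len P)); destruct (Rle_dec y (len P));
    repeat match goal with |- context [Rle_dec 0 ?z] => destruct (Rle_dec 0 z) end;
    unfold Rabs;
    repeat match goal with |- context [Rcase_abs ?z] => destruct (Rcase_abs z) end;
    lra.
Qed.

Lemma continuous_extension P (h : R -> R) :
  0 < len P -> continuous_on P h ->
  exists H, (forall x, continuity_pt H x) /\
    forall x, closed_itv P x -> H x = h x.
Proof.
  intros hL hh; exists (fun x => h (clamp P x)); split.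
  - intros x eps heps.
    destruct (hh (clamp P x) (clamp_closed P x hL) eps heps) as [d [hd H]].
    exists d; split; [assumption|intros y [_ hy]].
    simpl in *; unfold Rdist in *.
    destruct (Req_dec (clamp P y) (clamp P x)) as [->|hne].
    + rewrite Rminus_diag, Rabs_R0; lra.
    + apply H; split.
      * split; [now apply clamp_closed|auto].
      * pose proof (clamp_dist P x y); lra.
  - intros x hx; now rewrite clamp_id.
Qed.

(** Continuing [f] by its tangent lines beyond the two ends makes the one-sided
    derivatives there two-sided, so that the calculus of [is_derive] applies on
    all of [0, len]. *)
Lemma differentiable_extension P (f df : R -> R) :
  0 < len P -> derivative_of P f df ->
  exists F, (forall x, closed_itv P x -> F x = f x) /\
    forall x, closed_itv P x -> is_derive F x (df x).
Proof.
  intros hL hf.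
  set (F := fun x => f (clamp P x) + df (clamp P x) * (x - clamp P x)).
  assert (Fin : forall x, closed_itv P x -> F x = f x).
  { intros x hx; unfold F; rewrite clamp_id by assumption; ring. }
  exists F; split; [exact Fin|intros x hx].
  apply is_derive_Reals; intros eps heps.
  destruct (hf x hx eps heps) as [d [hd H]].
  assert (hd' : exists d', 0 < d' <= d /\ (0 < x -> d' <= x) /\
                  (x < len P -> d' <= len P - x)).
  { destruct (Req_dec x 0) as [->|h0];
      [|destruct (Req_dec x (len P)) as [->|h1]].
    - exists (Rmin d (len P)).
      unfold Rmin; destruct (Rle_dec d (len P)); repeat split; lra.
    - exists (Rmin d (len P)).
      unfold Rmin; destruct (Rle_dec d (len P)); repeat split; lra.
    - destruct hx; exists (Rmin d (Rmin x (len P - x))).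
      unfold Rmin; destruct (Rle_dec x (len P - x)); destruct (Rle_dec d _);
        repeat split; lra. }
  destruct hd' as [d' [[hd0 hdd] [hleft hright]]].
  exists (mkposreal d' hd0); intros h hne hh; simpl in hh.
  apply Rabs_def2 in hh.
  destruct (classic (closed_itv P (x + h))) as [hin|hout].
  - rewrite !Fin by assumption.
    specialize (H (x + h)); simpl in H; unfold Rdist in H.
    replace (x + h - x) with h in H by ring.
    apply H; split; [|apply Rabs_def1; lra].
    split; [assumption|lra].
  - (* By the choice of d', the point x is then the end point crossed. *)
    assert (hc : clamp P (x + h) = x).
    { unfold closed_itv in hx, hout; unfold clamp, Rmax, Rmin.
      destruct (Rle_dec (x + h) (len P)); destruct (Rle_dec 0 _);
        destruct (Rlt_dec 0 x); destruct (Rlt_dec x (len P)); lra. }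
    rewrite (Fin x hx); unfold F; rewrite hc.
    replace ((f x + df x * (x + h - x) - f x) / h - df x) with 0
      by (field; assumption).
    rewrite Rabs_R0; assumption.
Qed.

Lemma solves_ode_sl_system P lam f df :
  0 < len P -> positive_on P (p P) -> solves_ode P lam f df ->
  exists F W,
    sl_system (p P) (q P) (r P) lam 0 (len P) F W /\
    forall x, closed_itv P x -> F x = f x /\ W x = p P x * df x.
Proof.
  intros hL hp [hf [dflux [hw hode]]].
  destruct (differentiable_extension P f df hL hf) as [F [Ff F1]].
  destruct (differentiable_extension P _ dflux hL hw) as [W [Ww W1]].
  exists F, W; split; [|intros x hx; split; auto].
  intros x hx; specialize (hp x hx); split.
  - evar_last; [apply F1, hx|rewrite Ww by assumption; field; lra].
  - evar_last; [apply W1, hx|].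
    rewrite Ff by assumption; specialize (hode x hx); lra.
Qed.

Lemma coefficients_bound P lam :
  regular_coefficients P ->
  exists C, forall x, 0 <= x <= len P ->
    Rabs (/ p P x + (q P x - lam * r P x)) <= C.
Proof.
  intros [hL [[hp _] [[dp [hdp _]] [hq hr]]]].
  destruct (continuous_extension P (p P) hL) as [p' [cp ep]].
  { intros x hx; exact (cont_deriv _ _ _ _ (hdp x hx)). }
  destruct (continuous_extension P (q P) hL hq) as [q' [cq eq]].
  destruct (continuous_extension P (r P) hL hr) as [r' [cr er]].
  destruct (continuity_ab_maj
    (fun x => Rabs (/ p' x + (q' x - lam * r' x))) 0 (len P)) as [M [hM _]].
  - lra.
  - intros x hx.
    apply (continuity_pt_comp (fun x => / p' x + (q' x - lam * r' x)) Rabs).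
    + apply continuity_pt_plus.
      * apply continuity_pt_inv; [apply cp|].
        rewrite ep by assumption; specialize (hp x hx); lra.
      * apply continuity_pt_minus; [apply cq|].
        apply continuity_pt_scal, cr.
    + apply Rcontinuity_abs.
  - exists (Rabs (/ p' M + (q' M - lam * r' M))); intros x hx.
    rewrite <- ep, <- eq, <- er by assumption; exact (hM x hx).
Qed.

(** * The boundary value problem *)

(** The definition of a normalized solution imposes no condition at the right
    end.  At an eigenvalue it is inherited from some eigenfunction [g]: by
    uniqueness [g] is a multiple of [f], and not the zero multiple.  A zero of
    [f] at the right end would, by that condition, be a double one. *)
Lemma eigenfunction_system P lam l f :
  regular_coefficients P -> eigenvalue_indexing P lam ->
  normalized_solution P (lam l) f ->
  exists F W,
    sl_system (p P) (q P) (r P) (lam l) 0 (len P) F W /\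
    (forall x, closed_itv P x -> F x = f x) /\
    W 0 = p P 0 * (alpha1 P * lam l + alpha2 P) * F 0 /\
    W (len P) = p P (len P) * (beta1 P * lam l - beta2 P) * F (len P) /\
    F 0 <> 0 /\ F (len P) <> 0.
Proof.
  intros hreg hlam [df [hode [hleft f0]]].
  pose proof hreg as [hL [[hp _] _]].
  assert (i0 : closed_itv P 0) by (unfold closed_itv; lra).
  assert (iL : closed_itv P (len P)) by (unfold closed_itv; lra).
  destruct (coefficients_bound P (lam l) hreg) as [C hC].
  assert (heig : is_eigenvalue P (lam l)) by (apply hlam; now exists l).
  destruct heig as [g [dg [gode [gleft [gright [x1 [ix1 gx1]]]]]]].
  unfold left_bc, right_bc in *.
  destruct (solves_ode_sl_system P _ _ _ hL hp hode) as [F [W [hF eF]]].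
  destruct (solves_ode_sl_system P _ _ _ hL hp gode) as [G [V [hG eG]]].
  (* G is the multiple G 0 of F, as both satisfy the condition at 0. *)
  assert (hprop : forall x, closed_itv P x -> - G 0 * F x + G x = 0 /\
                    - G 0 * W x + V x = 0).
  { apply (sl_system_zero_data (p P) (q P) (r P) (lam l) 0 (len P) C
      (fun x => - G 0 * F x + G x) (fun x => - G 0 * W x + V x) 0 hC).
    - now apply sl_system_lincomb.
    - exact i0.
    - destruct (eF 0 i0) as [-> _]; rewrite f0; ring.
    - destruct (eF 0 i0) as [_ ->], (eG 0 i0) as [-> ->].
      rewrite gleft, hleft, f0; ring. }
  assert (G0 : G 0 <> 0).
  { intros e; apply gx1.
    destruct (eG x1 ix1) as [<- _], (hprop x1 ix1) as [H _].
    rewrite e in H; lra. }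
  assert (WL : W (len P) = p P (len P) * (beta1 P * lam l - beta2 P) * F (len P)).
  { destruct (hprop (len P) iL) as [H1 H2].
    apply (Rmult_eq_reg_l (G 0)); [|exact G0].
    replace (G 0 * W (len P)) with (V (len P)) by lra.
    replace (G 0 * (p P (len P) * (beta1 P * lam l - beta2 P) * F (len P)))
      with (p P (len P) * (beta1 P * lam l - beta2 P) * (G 0 * F (len P))) by ring.
    replace (G 0 * F (len P)) with (G (len P)) by lra.
    destruct (eG (len P) iL) as [-> ->]; rewrite gright; ring. }
  assert (F0 : F 0 <> 0) by (destruct (eF 0 i0) as [-> _]; lra).
  exists F, W; split; [exact hF|].
  split; [intros x hx; apply eF, hx|].
  split; [destruct (eF 0 i0) as [-> ->]; rewrite hleft; ring|].
  split; [exact WL|split; [exact F0|]].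
  intros FL; apply F0.
  apply (sl_system_zero_data (p P) (q P) (r P) (lam l) 0 (len P) C F W (len P));
    auto.
  rewrite WL, FL; ring.
Qed.

Lemma eigenvalue_indexing_pos P lam n :
  eigenvalue_indexing P lam -> 0 < lam (Plus n).
Proof.
  intros [_ [_ [_ [h0 [hS _]]]]].
  induction n as [|n IH]; [assumption|specialize (hS n); lra].
Qed.

Theorem corollary1p1 (P : sl_problem) (lam : label -> R) (n : nat)
    (f_n f_n1 : R -> R)
    (hreg : regular_coefficients P)
    (ha1 : 0 < alpha1 P) (hb1 : beta1 P < 0)
    (ha2 : 0 < alpha2 P) (hb2 : 0 < beta2 P)
    (hlam : eigenvalue_indexing P lam)
    (hf_n : normalized_solution P (lam (Plus n)) f_n)
    (hf_n1 : normalized_solution P (lam (Plus (S n))) f_n1) :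
  forall a b : R, consecutive_zeros P f_n1 a b ->
    exists! c : R, a < c < b /\ is_zero P f_n c.
Proof.
  intros a b [za [zb [hab hcons]]].
  pose proof (eigenvalue_indexing_pos P lam n hlam) as hpos.
  pose proof hreg as [hL [[hp [hq hr]] _]].
  unfold positive_on, closed_itv in hp, hq, hr.
  assert (hlt : lam (Plus n) < lam (Plus (S n))) by apply hlam.
  pose proof hlam as (_ & _ & _ & _ & _ & _ & hcount).
  destruct (hcount _ _ hf_n) as [cs [cnd [clen hcs]]].
  destruct (hcount _ _ hf_n1) as [ds [dnd [dlen hds]]].
  simpl in clen, dlen.
  destruct (eigenfunction_system P lam _ f_n hreg hlam hf_n)
    as [F [W [hF [eF [F0 [FL [nF0 nFL]]]]]]].
  destruct (eigenfunction_system P lam _ f_n1 hreg hlam hf_n1)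
    as [G [V [hG [eG [G0 [GL [nG0 nGL]]]]]]].
  assert (inF : forall x, 0 < x < len P -> F x = 0 -> In x cs).
  { intros x hx Fx; apply hcs; split; [exact hx|].
    rewrite <- eF; [exact Fx|unfold closed_itv; lra]. }
  assert (Fin : forall x, In x cs -> 0 < x < len P /\ F x = 0).
  { intros x hx; apply hcs in hx; destruct hx as [hx fx].
    split; [exact hx|rewrite eF; [exact fx|unfold closed_itv; lra]]. }
  assert (inG : forall x, 0 < x < len P -> G x = 0 -> In x ds).
  { intros x hx Gx; apply hds; split; [exact hx|].
    rewrite <- eG; [exact Gx|unfold closed_itv; lra]. }
  assert (hgap : forall c c', In c cs -> In c' cs -> c < c' ->
            exists d, In d ds /\ c < d < c').
  { intros c c' hc hc' hcc.
    destruct (list_nearest_above cs c c' hc' hcc) as [e [he [hce hmin]]].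
    specialize (hmin c' hc' hcc) as hec.
    destruct (Fin c hc) as [ic Fc], (Fin e he) as [ie Fe], (Fin c' hc') as [ic' _].
    destruct (sturm_comparison (p P) (q P) (r P) (lam (Plus n))
      (lam (Plus (S n))) c e F W G V) as [d [hd Gd]]; auto.
    - intros; apply hp; lra.
    - intros; apply hr; lra.
    - apply (sl_system_sub _ _ _ _ 0 (len P)); auto; lra.
    - apply (sl_system_sub _ _ _ _ 0 (len P)); auto; lra.
    - intros x hx Fx.
      assert (e <= x) by (apply hmin; [apply inF; [lra|exact Fx]|lra]); lra.
    - exists d; split; [apply inG; [lra|exact Gd]|lra]. }
  assert (hbelow : forall c, In c cs -> exists d, In d ds /\ d < c).
  { intros c hc; destruct (Fin c hc) as [ic Fc].
    destruct (list_nearest_above cs 0 c hc) as [e [he [h0e hmin]]]; [lra|].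
    specialize (hmin c hc ltac:(lra)) as hec.
    destruct (Fin e he) as [ie Fe].
    destruct (endpoint_comparison (p P) (q P) (r P) (lam (Plus n))
      (lam (Plus (S n))) (p P 0 * alpha1 P) (p P 0 * alpha2 P) 0 e F W G V)
      as [d [hd Gd]]; auto.
    - apply Rmult_lt_0_compat; [apply hp; lra|exact ha2].
    - intros; apply hp; lra.
    - intros; apply hq; lra.
    - intros; apply hr; lra.
    - apply (sl_system_sub _ _ _ _ 0 (len P)); auto; lra.
    - apply (sl_system_sub _ _ _ _ 0 (len P)); auto; lra.
    - rewrite F0; ring.
    - rewrite G0; ring.
    - intros x hx Fx.
      destruct (Req_dec x 0) as [->|hne]; [contradiction|].
      assert (e <= x) by (apply hmin; [apply inF; [lra|exact Fx]|lra]); lra.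
    - exists d; split; [apply inG; [lra|exact Gd]|lra]. }
  assert (habove : forall c, In c cs -> exists d, In d ds /\ c < d).
  { intros c hc; destruct (Fin c hc) as [ic Fc].
    destruct (list_nearest_below cs (len P) c hc) as [e [he [heL hmax]]]; [lra|].
    specialize (hmax c hc ltac:(lra)) as hec.
    destruct (Fin e he) as [ie Fe].
    (* Reflecting x to - x turns the right end into a left one; the flux
       changes sign, hence the coefficients - beta1 and beta2. *)
    destruct (endpoint_comparison (fun x => p P (- x)) (fun x => q P (- x))
      (fun x => r P (- x)) (lam (Plus n)) (lam (Plus (S n)))
      (p P (len P) * - beta1 P) (p P (len P) * beta2 P) (- len P) (- e)
      (fun x => F (- x)) (fun x => - W (- x))
      (fun x => G (- x)) (fun x => - V (- x))) as [d [hd Gd]];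
      rewrite ?Ropp_involutive; auto.
    - apply Rmult_lt_0_compat; [apply hp; lra|exact hb2].
    - intros; apply hp; lra.
    - intros; apply hq; lra.
    - intros; apply hr; lra.
    - apply sl_system_reflect, (sl_system_sub _ _ _ _ 0 (len P)); auto; lra.
    - apply sl_system_reflect, (sl_system_sub _ _ _ _ 0 (len P)); auto; lra.
    - rewrite FL; ring.
    - rewrite GL; ring.
    - intros x hx Fx.
      destruct (Req_dec (- x) (len P)) as [hxL|hne]; [now rewrite hxL in Fx|].
      assert (- x <= e) by (apply hmax; [apply inF; [lra|exact Fx]|lra]); lra.
    - exists (- d); split; [apply inG; [lra|exact Gd]|lra]. }
  destruct (interlacing_by_counting cs ds a b) as [c [hc hacb]]; auto.
  - lia.
  - now apply hds.
  - now apply hds.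
  - (* Two zeros of f_n in ]a, b[ would enclose a zero of f_n1. *)
    assert (huniq : forall x y, a < x < b -> a < y < b ->
      In x cs -> In y cs -> x < y -> False).
    { intros x y hx hy ix iy hxy.
      destruct (hgap x y ix iy hxy) as [d [hd hxdy]].
      apply (hcons d); [lra|now apply hds]. }
    exists c; split; [split; [exact hacb|now apply hcs]|].
    intros c' [hc' zc']; apply hcs in zc'.
    destruct (Rtotal_order c c') as [h|[h|h]]; [exfalso|exact h|exfalso]; eauto.
Qed.
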